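(* Let $n\geqslant1$ and let $\xi^1,\xi^2\in(0,1/2)$ be such that $1,\xi^1,\xi^2$ are linearly independent over $\mathbb Z$. Let $(x_{1,\nu},x_{2,\nu},x_{3,\nu})\in\mathbb Z^3$, $\nu=1,2,\dots$, be the extended best approximation vectors of the linear form $x_1\xi^1+x_2\xi^2$, i.e. $(x_{1,\nu},x_{2,\nu})$ runs through the best approximations for the $1\times2$ matrix $(\xi^1,\xi^2)$ and $x_{3,\nu}\in\mathbb Z$ satisfies $\|x_{1,\nu}\xi^1+x_{2,\nu}\xi^2\|=|x_{1,\nu}\xi^1+x_{2,\nu}\xi^2+x_{3,\nu}|$; put $M_\nu=\max_{i=1,2,3}|x_{i,\nu}|$. Suppose the series $\sum_{\nu=1}^\infty M_{\nu+1}^3\,\|x_{1,\nu}\xi^1+x_{2,\nu}\xi^2\|^n$ converges. For $(\theta^3_1,\dots,\theta^3_n)\in\mathbb R^n$ let $\Theta$ be the $n\times3$ matrix whose $j$-th row is $(\xi^1\theta^3_j,\ \xi^2\theta^3_j,\ \theta^3_j)$. Then for almost all $(\theta^3_1,\dots,\theta^3_n)$ with $0<\theta^3_2,\dots,\theta^3_n<1/2<\theta^3_1<1$, the sequence of extended best approximation vectors of $\Theta$ differs from the sequence $(x_{1,\nu},x_{2,\nu},x_{3,\nu},0,\dots,0)\in\mathbb Z^{3+n}$ by at most finitely many terms.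
   Context: For a real $n\times m$ matrix $\Theta=(\theta^i_j)$: $L_j(\mathbf x)=\sum_i\theta^i_jx_i$ for $\mathbf x\in\mathbb Z^m$; $\|\cdot\|$ = distance to nearest integer; $M(\mathbf x)=\max_i|x_i|$; $\zeta(\mathbf x)=\max_j\|L_j(\mathbf x)\|$. A nonzero $\mathbf x\in\mathbb Z^m$ is a best approximation if $\zeta(\mathbf x)\leqslant\zeta(\mathbf x')$ for all nonzero $\mathbf x'\in\mathbb Z^m$ with $M(\mathbf x')\leqslant M(\mathbf x)$. Its extended vector is $(\mathbf x,y_1,\dots,y_n)\in\mathbb Z^{m+n}$ with $y_j\in\mathbb Z$, $|L_j(\mathbf x)+y_j|=\|L_j(\mathbf x)\|$. Best approximations (up to sign) are listed in order of increasing $M(\mathbf x)$. *)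

(* Defs.v *)
From mathcomp Require Import all_boot all_order all_algebra.
From mathcomp Require Import all_classical all_reals all_analysis.
Import Order.TTheory GRing.Theory Num.Theory.
Import numFieldNormedType.Exports.

Set Implicit Arguments.
Unset Strict Implicit.
Unset Printing Implicit Defensive.

Local Open Scope classical_set_scope.
Local Open Scope ring_scope.

Definition dist_int (R : realType) (x : R) : R :=
  Num.min (x - (Num.floor x)%:~R) ((Num.ceil x)%:~R - x).

Definition sup_height (m : nat) (x : 'cV[int]_m) : nat :=
  (\max_(i < m) `|x i ord0|)%N.

Definition linform (R : realType) (n m : nat) (Theta : 'M[R]_(n, m))
    (j : 'I_n) (x : 'cV[int]_m) : R :=
  \sum_(i < m) Theta j i * (x i ord0)%:~R.

(* The starting value 0 is harmless, as all the distances are nonnegative. *)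
Definition zeta (R : realType) (n m : nat) (Theta : 'M[R]_(n, m))
    (x : 'cV[int]_m) : R :=
  \big[Num.max/0]_(j < n) dist_int (linform Theta j x).

Definition best_approx (R : realType) (n m : nat) (Theta : 'M[R]_(n, m))
    (x : 'cV[int]_m) : Prop :=
  x != 0 /\
  forall x' : 'cV[int]_m, x' != 0 -> (sup_height x' <= sup_height x)%N ->
    zeta Theta x <= zeta Theta x'.

(* [z] is the column (x, y) with x = usubmx z and y = dsubmx z. *)
Definition ext_best_approx (R : realType) (n m : nat) (Theta : 'M[R]_(n, m))
    (z : 'cV[int]_(m + n)) : Prop :=
  best_approx Theta (usubmx z) /\
  forall j : 'I_n,
    `| linform Theta j (usubmx z) + (dsubmx z j ord0)%:~R |
      = dist_int (linform Theta j (usubmx z)).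

(* [Z] lists the extended best approximation vectors, exactly one for each best
   approximation up to sign. If several best approximations, different up to
   sign, have the same height, they may be listed in any order; if a value
   L_j(x) is a half-integer, either of the two possible y_j may be chosen. *)
Definition ext_best_approx_seq (R : realType) (n m : nat)
    (Theta : 'M[R]_(n, m)) (Z : nat -> 'cV[int]_(m + n)) : Prop :=
  [/\ forall k, ext_best_approx Theta (Z k),
      forall k l, (k <= l)%N ->
        (sup_height (usubmx (Z k)) <= sup_height (usubmx (Z l)))%N,
      forall k l, usubmx (Z k) = usubmx (Z l) \/ usubmx (Z k) = - usubmx (Z l) ->
        k = l
    & forall x, best_approx Theta x ->
        exists k, usubmx (Z k) = x \/ usubmx (Z k) = - x].

(* Vectors being considered up to sign, the two sequences coincide after
   deleting finitely many terms from each of them. *)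
Definition differ_by_finitely_many_terms (d : nat)
    (Z W : nat -> 'cV[int]_d) : Prop :=
  exists k0 l0 : nat, forall k,
    Z (k0 + k)%N = W (l0 + k)%N \/ Z (k0 + k)%N = - W (l0 + k)%N.

(* Sets of Lebesgue measure zero in R^n, for n >= 1: those which, for every
   positive eps, are covered by countably many boxes of total volume <= eps. *)
Definition lebesgue_null (R : realType) (n : nat) (N : set 'rV[R]_n) : Prop :=
  forall eps : R, 0 < eps ->
  exists a b : nat -> 'rV[R]_n,
    [/\ forall k i, a k ord0 i <= b k ord0 i,
        N `<=` \bigcup_k
          [set t | forall i, a k ord0 i <= t ord0 i <= b k ord0 i]
      & (\sum_(0 <= k <oo) (\prod_(i < n) (b k ord0 i - a k ord0 i))%:E
          <= eps%:E)%E].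

(* Main.v *)
Require Import Defs.
From mathcomp Require Import all_boot all_order all_algebra.
From mathcomp Require Import all_classical all_reals all_analysis.
From mathcomp Require Import zify ring lra.
Import Order.TTheory GRing.Theory Num.Theory.
Import numFieldNormedType.Exports.

Set Implicit Arguments.
Unset Strict Implicit.
Unset Printing Implicit Defensive.

Local Open Scope classical_set_scope.
Local Open Scope ring_scope.

(* Put l(w) = w_1 xi1 + w_2 xi2 + w_3, so that L_j(w) = theta_j l(w). If
   |l(w)| <= 1/2, then all theta_j l(w) lie in (-1/2, 1/2) and
   zeta(w) = theta_1 |l(w)|, because theta_1 is the largest theta_j. Hence, among
   such w of height < M_(k+1), only +-X_k comes as close as X_k. If
   |l(w)| > 1/2, the set of theta in [0, 1]^n with ||theta_j l(w)|| <= |l(X_k)|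
   for all j is covered by boxes of total volume (8 |l(X_k)|)^n. There are at most
   8 M_(k+1)^3 such w of height < M_(k+1), so the Borel-Cantelli argument applies. *)

(** * Distance to the nearest integer *)

Section DistInt.
Variable R : realType.
Implicit Types x : R.

Lemma dist_int_le x (a : int) : dist_int x <= `|x - a%:~R|.
Proof.
rewrite /dist_int ge_min; case: (leP a%:~R x) => [ax|xa].
  apply/orP; left; rewrite ger0_norm ?subr_ge0// lerD2l lerN2 ler_int.
  by rewrite floor_ge_int.
apply/orP; right; rewrite ler0_norm ?subr_le0 ?(ltW xa)// opprB lerD2r ler_int.
by rewrite ceil_le_int ltW.
Qed.

Lemma dist_int_attained x : exists a : int, dist_int x = `|x - a%:~R|.
Proof.
rewrite /dist_int /Num.min; case: ifP => _.
  by exists (Num.floor x); rewrite ger0_norm// subr_ge0 floor_le.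
by exists (Num.ceil x); rewrite ler0_norm ?opprB// subr_le0 ceil_ge.
Qed.

Lemma dist_int_ge0 x : 0 <= dist_int x.
Proof. by have [a ->] := dist_int_attained x. Qed.

Lemma dist_int_le_half x : dist_int x <= 2^-1.
Proof.
have cf : (Num.ceil x)%:~R <= (Num.floor x)%:~R + 1 :> R.
  by rewrite -[1]/(1%:~R) -intrD ler_int ceil_floor lerD2l; case: (_ \isn't a _).
rewrite /dist_int ge_min; set a := _%:~R; set b := _%:~R.
by case: (leP (x - a) 2^-1) => //= h; rewrite -/a -/b in cf; lra.
Qed.

Lemma dist_int_norm x : `|x| <= 2^-1 -> dist_int x = `|x|.
Proof.
move=> hx; apply/eqP; rewrite eq_le; apply/andP; split.
  by have := dist_int_le x 0; rewrite subr0.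
have [a ->] := dist_int_attained x; have [->|a0] := eqVneq a 0.
  by rewrite subr0.
have : 1 <= `|a%:~R| :> R by rewrite -intr_norm -[1]/(1%:~R) ler_int; lia.
by have := ler_normB x (x - a%:~R); rewrite opprB addrC subrK; lra.
Qed.

Lemma dist_intN x : dist_int (- x) = dist_int x.
Proof.
wlog suff: x / dist_int (- x) <= dist_int x.
  move=> h; apply/eqP; rewrite eq_le h/=.
  by have := h (- x); rewrite opprK.
have [a ->] := dist_int_attained x.
by have := dist_int_le (- x) (- a); rewrite -normrN mulrNz opprB opprK addrC.
Qed.

End DistInt.

(** * Integer vectors of bounded height *)

Section Height.
Variable m : nat.
Implicit Types v : 'cV[int]_m.

Lemma sup_heightN v : sup_height (- v) = sup_height v.
Proof. by apply: eq_bigr => i _; rewrite mxE abszN. Qed.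

Lemma le_sup_height v i : (`|v i ord0| <= sup_height v)%N.
Proof. exact: (@leq_bigmax _ (fun i => `|v i ord0|%N)). Qed.

Lemma sup_height_gt0 v : v != 0 -> (0 < sup_height v)%N.
Proof.
move=> v0; rewrite lt0n; apply: contra v0 => /eqP h; apply/eqP/colP => i.
by have := le_sup_height v i; rewrite h leqn0 absz_eq0 mxE => /eqP.
Qed.

(** Shifting by [H] parametrises the vectors of height at most [H] by a finite type, which serves
    both to take minima and to count. *)
Definition box_vector (H : nat) (f : {ffun 'I_m -> 'I_(2 * H).+1}) : 'cV[int]_m :=
  \col_i ((f i)%:Z - H%:Z).

Lemma box_vector_onto H v : (sup_height v <= H)%N ->
  exists f : {ffun 'I_m -> 'I_(2 * H).+1}, box_vector f = v.
Proof.
move=> hv; exists [ffun i => inord (absz (v i ord0 + H%:Z))].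
apply/colP => i; rewrite !mxE ffunE.
have := leq_trans (le_sup_height v i) hv; move: (v i ord0) => a ha.
by rewrite inordK; lia.
Qed.

Lemma min_of_bounded_height (R : realType) (F : 'cV[int]_m -> R) v H :
  v != 0 -> (sup_height v <= H)%N ->
  exists u, [/\ u != 0, (sup_height u <= H)%N &
    forall w, w != 0 -> (sup_height w <= H)%N -> F u <= F w].
Proof.
move=> v0 vH; have [f fv] := box_vector_onto vH.
pose P (g : {ffun 'I_m -> 'I_(2 * H).+1}) :=
  (box_vector g != 0) && (sup_height (box_vector g) <= H)%N.
have Pf : P f by rewrite /P fv v0.
case: (@arg_minP _ _ _ f P (fun g => F (box_vector g)) Pf) => g /andP[g0 gH] gm.
exists (box_vector g); split => // w w0 wH; have [h hw] := box_vector_onto wH.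
by rewrite -hw; apply: gm; rewrite /P hw w0.
Qed.

End Height.

Lemma sup_height_ext (w : 'cV[int]_(2 + 1)) :
  sup_height w = maxn (sup_height (usubmx w)) `|dsubmx w ord0 ord0|.
Proof.
rewrite /sup_height big_split_ord/= big_ord1.
by congr maxn; [apply: eq_bigr => i _|]; rewrite mxE.
Qed.

(** * Best approximations of the form [x_1 xi1 + x_2 xi2 + x_3] *)

Section RealForm.
Variables (R : realType) (xi1 xi2 : R).
Hypotheses (xi1_bd : 0 < xi1 < 2^-1) (xi2_bd : 0 < xi2 < 2^-1).
Hypothesis indep : forall a b c : int,
  a%:~R + b%:~R * xi1 + c%:~R * xi2 = 0 -> [/\ a = 0, b = 0 & c = 0].

Let rho : 'M[R]_(1, 2) := \row_(i < 2) [:: xi1; xi2]`_i.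
Let L (v : 'cV[int]_2) : R := linform rho ord0 v.

Definition ext_form (w : 'cV[int]_(2 + 1)) : R :=
  linform (\row_(i < 2) [:: xi1; xi2]`_i) ord0 (usubmx w)
  + (dsubmx w ord0 ord0)%:~R.
Let l := ext_form.

Lemma linformE v : L v = (v ord0 ord0)%:~R * xi1 + (v ord_max ord0)%:~R * xi2.
Proof.
rewrite /L /linform big_ord_recl big_ord1 !mxE/= !(mulrC xi1) !(mulrC xi2).
by congr (_ + (v _ _)%:~R * _); exact: val_inj.
Qed.

Lemma ext_formE w : l w = L (usubmx w) + (dsubmx w ord0 ord0)%:~R.
Proof. by []. Qed.

Lemma ext_form_linear a b u w : l (a *: u + b *: w) = a%:~R * l u + b%:~R * l w.
Proof. by rewrite !ext_formE !linformE !mxE !rmorphD/= !rmorphM/=; ring. Qed.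

Lemma ext_form0 w : l w = 0 -> w = 0.
Proof.
rewrite ext_formE linformE addrC addrA => /indep[h1 h2 h3].
rewrite -[w]vsubmxK; suff -> : usubmx w = 0.
  by suff -> : dsubmx w = 0; [rewrite col_mx0|apply/colP => i; rewrite ord1 h1 mxE].
apply/colP => i; rewrite [RHS]mxE; case: (unliftP ord_max i) => [j|] -> //.
by rewrite -[RHS]h2 ord1; congr (usubmx w _ _); exact: val_inj.
Qed.

(** By linearity [u - w] or [u + w] is a zero of the form, and linear independence leaves only the
    zero vector. *)
Lemma ext_form_inj u w : `|l u| = `|l w| -> u = w \/ u = - w.
Proof.
move/eqP; rewrite eqr_norm2 => /orP[]/eqP h; [left|right]; apply/eqP.
  rewrite -subr_eq0; apply/eqP/ext_form0.
  by rewrite -/l -[u]scale1r -scaleN1r ext_form_linear h; ring.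
rewrite -addr_eq0; apply/eqP/ext_form0.
by rewrite -/l -[u]scale1r -[w]scale1r ext_form_linear h; ring.
Qed.

Lemma zeta_row v : zeta rho v = dist_int (L v).
Proof. by rewrite /zeta big_ord_recl big_ord0; apply/max_idPl/dist_int_ge0. Qed.

Lemma dist_int_linform_le w : dist_int (L (usubmx w)) <= `|l w|.
Proof.
have := dist_int_le (L (usubmx w)) (- dsubmx w ord0 ord0).
by rewrite mulrNz opprK.
Qed.

(** Appending a nearest integer, with opposite sign, as third coordinate turns the distances into
    values of [|l|], so [ext_form_inj] applies. *)
Lemma dist_int_linform_inj u v : dist_int (L u) = dist_int (L v) -> u = v \/ u = - v.
Proof.
have ex x : exists2 w : 'cV[int]_(2 + 1), usubmx w = x & dist_int (L x) = `|l w|.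
  have [a ->] := dist_int_attained (L x).
  exists (col_mx x (const_mx (- a))); rewrite ?col_mxKu//.
  by rewrite /l /ext_form col_mxKu col_mxKd mxE mulrNz.
have [w <- ->] := ex u; have [z <- ->] := ex v.
by case/ext_form_inj => ->; [left|right; rewrite linearN].
Qed.

Variable X : nat -> 'cV[int]_(2 + 1).
Hypothesis hX : ext_best_approx_seq rho X.

Lemma best_dist k : dist_int (L (usubmx (X k))) = `|l (X k)|.
Proof. by have [/(_ k)[_ /(_ ord0)]] := hX. Qed.

Lemma best_ext_form_le_half k : `|l (X k)| <= 2^-1.
Proof. by rewrite -best_dist dist_int_le_half. Qed.

Lemma best_usubmx_neq0 k : usubmx (X k) != 0.
Proof. by have [/(_ k)[[]]] := hX. Qed.

Lemma best_neq0 k : X k != 0.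
Proof. by apply: contra (best_usubmx_neq0 k) => /eqP ->; rewrite linear0. Qed.

(** As [xi1] and [xi2] are below 1/2, the third coordinate has absolute value at most
    [H/2 + H/2 + 1/2 < H + 1], where [H] is the height of the first two. So [M_k] is also the height
    by which the best approximations are ordered. *)
Lemma best_sup_height k : sup_height (X k) = sup_height (usubmx (X k)).
Proof.
rewrite sup_height_ext; apply/maxn_idPl.
have := best_ext_form_le_half k; rewrite ext_formE linformE.
have h0 := le_sup_height (usubmx (X k)) ord0.
have h1 := le_sup_height (usubmx (X k)) ord_max.
have H0 := sup_height_gt0 (best_usubmx_neq0 k).
move: (usubmx (X k) ord0 ord0) (usubmx (X k) ord_max ord0) h0 h1.
move: (dsubmx (X k) ord0 ord0) (sup_height _) H0 => d H H0 a b.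
rewrite -(ler_nat R) natr_absz intr_norm => ha.
rewrite -(ler_nat R) natr_absz intr_norm => hb hd.
rewrite -ltnS -(ltr_nat R) natr_absz intr_norm -natr1.
have e : d%:~R = (a%:~R * xi1 + b%:~R * xi2 + d%:~R) - a%:~R * xi1 - b%:~R * xi2 :> R.
  by ring.
have := ler_normB (a%:~R * xi1 + b%:~R * xi2 + d%:~R - a%:~R * xi1) (b%:~R * xi2).
have := ler_normB (a%:~R * xi1 + b%:~R * xi2 + d%:~R) (a%:~R * xi1).
have [/andP[x1 ?] /andP[x2 ?]] := (xi1_bd, xi2_bd).
rewrite -e !normrM (gtr0_norm x1) (gtr0_norm x2).
have : 1 <= H%:R :> R by rewrite ler1n.
move: ha hb; set x := `|a%:~R|; set y := `|b%:~R|; set h := H%:R => xh yh h1.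
have : x * xi1 <= h / 2 by apply: ler_pM; [exact: normr_ge0|exact: ltW| |exact: ltW].
have : y * xi2 <= h / 2 by apply: ler_pM; [exact: normr_ge0|exact: ltW| |exact: ltW].
by move: hd; lra.
Qed.

(** Two best approximations of the same height have the same distance, hence agree up to sign, and
    the list contains each only once. *)
Lemma best_height_mono k i : (k < i)%N -> (sup_height (X k) < sup_height (X i))%N.
Proof.
have [hb hm hu _] := hX; move=> ki; rewrite ltn_neqAle !best_sup_height.
rewrite (hm _ _ (ltnW ki)) andbT; apply/negP => /eqP e.
have [[kn0 hk] _] := hb k; have [[in0 hi] _] := hb i.
have /eqP : zeta rho (usubmx (X k)) == zeta rho (usubmx (X i)).
  by rewrite eq_le hk ?hi ?e.
by rewrite !zeta_row => /dist_int_linform_inj/hu eki; rewrite eki ltnn in ki.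
Qed.

(** A minimiser [u] of the distance among nonzero vectors of height below [M_(k+1)] is itself a best
    approximation. It is therefore listed at some index [i <= k], and [X k] does at least as well as
    [u]. *)
Lemma best_dist_min k v : v != 0 -> (sup_height v < sup_height (X k.+1))%N ->
  `|l (X k)| <= dist_int (L v).
Proof.
move=> v0 hv; have hH : (sup_height v <= (sup_height (X k.+1)).-1)%N by lia.
have [u [u0 uH um]] := min_of_bounded_height (fun v => dist_int (L v)) v0 hH.
apply: le_trans (um _ v0 hH); have [hb _ _ hex] := hX.
have /hex[i hi] : best_approx rho u.
  split=> // w w0 wu; rewrite !zeta_row; apply: um => //; lia.
have hiu : sup_height (X i) = sup_height u.
  by rewrite best_sup_height; case: hi => ->; rewrite ?sup_heightN.
have ik : (i <= k)%N.
  rewrite leqNgt; apply/negP; rewrite leq_eqVlt => /orP[/eqP e|/best_height_mono].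
    by rewrite e hiu in hH hv uH *; lia.
  by rewrite hiu; lia.
have [[_ hk] _] := hb k; rewrite -best_dist -!zeta_row; apply: hk => //.
by rewrite -hiu -best_sup_height; move: ik; rewrite leq_eqVlt => /orP[/eqP->//|/best_height_mono/ltnW].
Qed.

(** By [best_dist_min] the value [|l w|] is also at least [|l (X k)|], and equality of the two
    determines [w] up to sign. *)
Lemma best_unique k w : w != 0 -> (sup_height w < sup_height (X k.+1))%N ->
  `|l w| <= `|l (X k)| -> w = X k \/ w = - X k.
Proof.
move=> w0 hw hl; apply: ext_form_inj; apply/eqP; rewrite eq_le hl/=.
apply: le_trans (dist_int_linform_le w); apply: best_dist_min.
  (* If the first two coordinates of [w] vanished, [l w] would be a nonzero integer, whereas
     [|l w| <= |l (X k)| <= 1/2]. *)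
  apply: contraNN w0 => /eqP u0.
  have /eqP := u0; have := hl; rewrite ext_formE u0 linformE !mxE !mul0r addr0 add0r.
  move=> hd _; have := le_trans hd (best_ext_form_le_half k) => hd2.
  rewrite -[w]vsubmxK u0; suff -> : dsubmx w = 0 by rewrite col_mx0.
  apply/colP => i; rewrite ord1 [RHS]mxE; apply/eqP; apply: contraTT hd2 => d0.
  rewrite -ltNge; apply: (@lt_le_trans _ _ 1); first by lra.
  by rewrite -intr_norm -[1]/(1%:~R) ler_int -gtz0_ge1 normr_gt0; move: d0; rewrite mxE.
by apply: leq_ltn_trans hw; rewrite sup_height_ext leq_maxl.
Qed.

End RealForm.

(** * Finite coverings by boxes *)

Section Boxes.
Variables (R : realType) (n : nat).
Implicit Types (p : 'rV[R]_n * 'rV[R]_n) (t : 'rV[R]_n).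

Definition box_vol p : R := \prod_(i < n) (p.2 ord0 i - p.1 ord0 i).

Definition is_box p : Prop := forall i, p.1 ord0 i <= p.2 ord0 i.

Definition in_box p t : Prop := forall i, p.1 ord0 i <= t ord0 i <= p.2 ord0 i.

(** Explicit lists of boxes replace Lebesgue measure here, to match the coverings in
    [lebesgue_null]. *)
Definition finitely_covered (A : set 'rV[R]_n) (c : R) : Prop :=
  exists s, [/\ forall p, p \in s -> is_box p,
    forall t, A t -> exists2 p, p \in s & in_box p t
    & \sum_(p <- s) box_vol p <= c].

Lemma box_vol_ge0 p : is_box p -> 0 <= box_vol p.
Proof. by move=> hp; apply: prodr_ge0 => i _; rewrite subr_ge0. Qed.

Lemma finitely_coveredW (A : set 'rV[R]_n) (c d : R) :
  c <= d -> finitely_covered A c -> finitely_covered A d.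
Proof. by move=> cd [s [h1 h2 h3]]; exists s; split => //; exact: le_trans h3 cd. Qed.

Lemma finitely_covered_bigU (T : finType) (A : T -> set 'rV[R]_n) (c : R) :
  (forall x, finitely_covered (A x) c) ->
  finitely_covered (\bigcup_x A x) (#|T|%:R * c).
Proof.
move=> /choice[s hs]; exists (flatten [seq s x | x <- enum T]); split.
- by move=> p /flatten_mapP[x _]; have [h _ _] := hs x; exact: h.
- move=> t [x _ Axt]; have [_ /(_ t Axt)[p ps pt] _] := hs x.
  by exists p => //; apply/flatten_mapP; exists x; rewrite ?mem_enum.
rewrite big_flatten big_map big_enum/= mulr_natl -sumr_const.
by apply: ler_sum => x _; have [] := hs x.
Qed.

(* There are N <= lam + 3/2 admissible nearest integers, hence N^n boxes of side
   2z / lam, and N * (2z / lam) <= 8z since lam > 1/2. *)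
Lemma slab_covered (lam z : R) : 2^-1 < lam -> 0 <= z -> z <= 2^-1 ->
  finitely_covered [set t | forall i, (0 <= t ord0 i <= 1)
    /\ dist_int (t ord0 i * lam) <= z] ((8 * z) ^+ n).
Proof.
move=> lam2 z0 z2; have lam0 : 0 < lam by lra.
pose N := (Num.truncn (lam + 2^-1)).+1.
have hN : N%:R <= lam + 3 / 2.
  rewrite /N -natr1; have /andP[h _] : _ := @truncn_itv _ (lam + 2^-1) ltac:(lra).
  by move: h; lra.
pose B (f : {ffun 'I_n -> 'I_N}) : 'rV[R]_n * 'rV[R]_n :=
  (\row_i (((f i)%:R - z) / lam), \row_i (((f i)%:R + z) / lam)).
exists [seq B f | f <- enum {ffun 'I_n -> 'I_N}]; split.
- by move=> p /mapP[f _ ->] i; rewrite !mxE ler_pM2r ?invr_gt0//; lra.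
- move=> t ht.
  (* Since [0 <= t_i * lam <= lam] and [z <= 1/2], a nearest integer lies between -1/2 and
     [lam + 1/2], so it is one of 0, ..., [N - 1]. *)
  have ex i : exists a : 'I_N, `|t ord0 i * lam - a%:R| <= z.
    have [/andP[t0 t1]] := ht i; have [a ->] := dist_int_attained (t ord0 i * lam).
    rewrite ler_norml => /andP[h1 h2].
    have tl : t ord0 i * lam <= lam by rewrite ger_pMl.
    have tl0 : 0 <= t ord0 i * lam by rewrite mulr_ge0 // ltW.
    have a0 : (0 <= a :> int).
      rewrite leNgt; apply/negP => a0.
      have : a%:~R <= -1 :> R by rewrite -[-1]/((-1)%:~R) ler_int; lia.
      by move: h1 h2; lra.
    case: a a0 h1 h2 => // a _; rewrite -pmulrn => h1 h2.
    have aN : (a < N)%N.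
      by rewrite /N ltnS truncn_ge_nat; lra.
    by exists (Ordinal aN); rewrite ler_norml/= h1.
  have [f hf] := choice ex; exists (B (finfun f)).
    by apply/mapP; exists (finfun f); rewrite ?mem_enum.
  move=> i; rewrite !mxE ffunE ler_pdivrMr // ler_pdivlMr //.
  by have := hf i; rewrite ler_norml => /andP[? ?]; apply/andP; split; lra.
rewrite big_map big_enum/=.
under eq_bigr => f _ do (rewrite /box_vol; under eq_bigr => i _ do
  rewrite !mxE -mulrBl opprD opprK addrACA subrr add0r -mulr2n).
rewrite sumr_const !prodr_const card_ffun !card_ord -(mulr_natl (_ ^+ n)) natrX -exprMn.
apply: lerXn2r; rewrite ?nnegrE ?mulr_ge0 ?invr_ge0 ?mulrn_wge0 ?(ltW lam0)//.
rewrite mulrA ler_pdivrMr // -mulr_natl.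
have : N%:R * z <= (lam + 3 / 2) * z by apply: ler_wpM2r.
have : 2^-1 * z <= lam * z by apply: ler_wpM2r => //; exact: ltW.
by lra.
Qed.

End Boxes.

(** * Countable coverings of small total volume *)

Lemma ler_sum_subset (R : numDomainType) (I : eqType) (S T : seq I) (g : I -> R) :
  uniq S -> uniq T -> {subset S <= T} -> (forall i, 0 <= g i) ->
  \sum_(i <- S) g i <= \sum_(i <- T) g i.
Proof.
move=> uS uT ST g0; rewrite [leRHS](bigID (mem S))/= -[X in _ <= X + _]big_filter.
rewrite [X in _ <= X + _](perm_big S)/=; last first.
  apply: uniq_perm => //; first exact: filter_uniq.
  by move=> i; rewrite mem_filter/= andb_idr//; exact: ST.
by rewrite lerDl sumr_ge0.
Qed.

Section NullSets.
Variables (R : realType) (n : nat).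
Hypothesis n_gt0 : (0 < n)%N.

(* The boxes of the lists s 0, s 1, ... are interleaved along an enumeration of
   nat * nat and padded with the degenerate box (0, 0). *)
Lemma cover_of_finite_covers (A : nat -> set 'rV[R]_n) (c : nat -> R) (eps : R) :
  (forall k, finitely_covered (A k) (c k)) ->
  (forall K, \sum_(k < K) c k <= eps) ->
  exists a b : nat -> 'rV[R]_n,
    [/\ forall k i, a k ord0 i <= b k ord0 i,
        \bigcup_k A k `<=` \bigcup_k
          [set t | forall i, a k ord0 i <= t ord0 i <= b k ord0 i]
      & (\sum_(0 <= k <oo) (\prod_(i < n) (b k ord0 i - a k ord0 i))%:E
          <= eps%:E)%E].
Proof.
move=> /choice[s hs] hc.
pose o : 'rV[R]_n * 'rV[R]_n := (0, 0).
pose F (q : nat * nat) := nth o (s q.1) q.2.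
pose G k := if (pickle_inv k : option (nat * nat)) is Some q then F q else o.
have Fbox q : is_box (F q).
  rewrite /F; case: (ltnP q.2 (size (s q.1))) => h.
    by have [hb _ _] := hs q.1; apply: hb; rewrite mem_nth.
  by rewrite nth_default // => i; rewrite /= lexx.
have obox : is_box o by move=> i; rewrite /= lexx.
(* Here [n > 0] matters: the empty product would give the padding boxes volume 1. *)
have vol0 : box_vol o = 0.
  by apply/eqP; rewrite prodf_seq_eq0; apply/hasP; exists (Ordinal n_gt0);
    rewrite ?mem_index_enum // !mxE subrr eqxx.
have Gbox k : is_box (G k) by rewrite /G; case: pickle_inv.
have c0 k : 0 <= c k.
  have [hb _] := hs k; apply: le_trans; rewrite big_seq; apply: sumr_ge0 => p /hb.
  exact: box_vol_ge0.
exists (fun k => (G k).1), (fun k => (G k).2); split; first exact: Gbox.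
  move=> t [k _ Akt]; have [_ /(_ t Akt)[p ps pt] _] := hs k.
  exists (pickle (k, index p (s k))) => //=; rewrite /G pickleK_inv /F /= nth_index //.
have part K : \sum_(k < K) box_vol (G k) <= eps.
  (* [S] holds the distinct pairs with code below [K]. Those pointing past the end of their list
     contribute 0, and the others lie in the array [T] of all genuine positions in the first [Q]
     lists. *)
  pose S := pmap (fun k => pickle_inv k : option (nat * nat)) (iota 0 K).
  have -> : \sum_(k < K) box_vol (G k) = \sum_(q <- S) box_vol (F q).
    rewrite -(big_mkord xpredT (fun k => box_vol (G k))) /index_iota subn0 /S.
    elim: (iota 0 K) => [|k r IH]; first by rewrite !big_nil.
    rewrite big_cons IH /= {1}/G; case: pickle_inv => [q|] /=; first by rewrite big_cons.
    by rewrite vol0 add0r.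
  have uS : uniq S.
    apply: (pmap_uniq (g := @pickle (nat * nat)%type)); last exact: iota_uniq.
    exact: pickle_invK.
  pose Q := (\max_(q <- S) q.1).+1.
  apply: le_trans (hc Q).
  have inside q : ~~ (q.2 < size (s q.1))%N -> box_vol (F q) = 0.
    by rewrite -leqNgt => h; rewrite /F nth_default.
  rewrite -(big_rmcond _ _ inside) -big_filter.
  pose T := [seq (k, i) | k <- iota 0 Q, i <- iota 0 (size (s k))].
  apply: (@le_trans _ _ (\sum_(q <- T) box_vol (F q))).
    apply: ler_sum_subset; rewrite ?filter_uniq//.
    - apply: allpairs_uniq_dep => [|k _|[k i] [k' i'] _ _ /= [-> ->]//].
        exact: iota_uniq.
      exact: iota_uniq.
    - move=> [k i]; rewrite mem_filter/= => /andP[ki qS].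
      apply/allpairsPdep; exists k, i; rewrite !mem_iota !add0n/=; split => //.
      by rewrite ltnS; exact: (@leq_bigmax_seq _ S xpredT (fun q => q.1) (k, i) qS isT).
    - by move=> q; exact: box_vol_ge0.
  rewrite big_allpairs_dep -(big_mkord xpredT c) /index_iota subn0.
  apply: ler_sum => k _; have [_ _ h] := hs k; apply: le_trans h.
  by rewrite [leRHS](big_nth o) /index_iota subn0.
apply: lime_le; first by apply: is_cvg_nneseries => k _ _; rewrite lee_fin box_vol_ge0.
by apply: nearW => K; rewrite sumEFin lee_fin big_mkord.
Qed.

End NullSets.

(** * Recognising the tail of a sequence of best approximations *)

Section GenericBestApprox.
Variables (R : realType) (n m : nat) (Theta : 'M[R]_(n, m)).

Lemma linformN j (w : 'cV[int]_m) : linform Theta j (- w) = - linform Theta j w.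
Proof.
by rewrite /linform -sumrN; apply: eq_bigr => i _; rewrite mxE mulrNz mulrN.
Qed.

Lemma zetaN (w : 'cV[int]_m) : zeta Theta (- w) = zeta Theta w.
Proof. by apply: eq_bigr => j _; rewrite linformN dist_intN. Qed.

Lemma le_zeta j (w : 'cV[int]_m) : dist_int (linform Theta j w) <= zeta Theta w.
Proof. exact: (le_bigmax _ (fun j => dist_int (linform Theta j w))). Qed.

(** The gap condition makes each [W l] with [l0 <= l] a best approximation, and the only one up to
    sign with height in the interval from that of [W l] to that of [W l.+1], right end excluded. So
    [Z] and [W] advance in step once they meet. *)
Lemma ext_best_approx_seq_tail (Z : nat -> 'cV[int]_(m + n))
    (W : nat -> 'cV[int]_m) (l0 : nat) :
  ext_best_approx_seq Theta Z ->
  (forall l, W l != 0) ->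
  (forall k l, (k < l)%N -> (sup_height (W k) < sup_height (W l))%N) ->
  (forall l w, (l0 <= l)%N -> w != 0 -> (sup_height w < sup_height (W l.+1))%N ->
    ~ (w = W l \/ w = - W l) -> zeta Theta (W l) < zeta Theta w) ->
  exists k0, forall i, usubmx (Z (k0 + i)%N) = W (l0 + i)%N
    \/ usubmx (Z (k0 + i)%N) = - W (l0 + i)%N.
Proof.
move=> [hb hm hu hex] W0 Wmono gap.
have heightZ k l : usubmx (Z k) = W l \/ usubmx (Z k) = - W l ->
    sup_height (usubmx (Z k)) = sup_height (W l).
  by case=> ->; rewrite ?sup_heightN.
have Wbest l : (l0 <= l)%N -> best_approx Theta (W l).
  move=> ll; split=> // w w0 wl.
  have [[->|->]|h] := EM (w = W l \/ w = - W l); rewrite ?zetaN//.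
  by apply/ltW/gap => //; apply: leq_ltn_trans wl (Wmono _ _ (ltnSn l)).
(* Being a best approximation at least as high as [W l], the vector [Z k] has [zeta] at most that of
   [W l], against the gap unless it is [W l] up to sign. *)
have between k l : (l0 <= l)%N -> (sup_height (W l) <= sup_height (usubmx (Z k)))%N ->
    (sup_height (usubmx (Z k)) < sup_height (W l.+1))%N ->
    usubmx (Z k) = W l \/ usubmx (Z k) = - W l.
  move=> ll h1 h2; apply: contrapT => h; have [[Zk0 hk] _] := hb k.
  by have := gap l _ ll Zk0 h2 h; rewrite ltNge hk.
have [k0 hk0] := hex _ (Wbest l0 (leqnn _)); exists k0; elim=> [|i IH].
  by rewrite !addn0.
rewrite !addnS; set k := (k0 + i)%N in IH *; set l := (l0 + i)%N in IH *.
have ll : (l0 <= l)%N by exact: leq_addr.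
have [k' hk'] := hex _ (Wbest l.+1 (leqW ll)).
have kk' : (k < k')%N.
  rewrite ltnNge; apply/negP => /hm; rewrite (heightZ _ _ hk') (heightZ _ _ IH).
  by rewrite leqNgt Wmono.
(* Either [Z k.+1] has the height of [W l.+1], and [between] identifies it, or it is lower and
   repeats [W l] up to sign, which is already listed at [k]. *)
have := hm _ _ kk'; rewrite (heightZ _ _ hk') leq_eqVlt => /orP[/eqP e|lt].
  by apply: between; rewrite ?e ?Wmono//; exact: leqW.
have same : usubmx (Z k.+1) = W l \/ usubmx (Z k.+1) = - W l.
  by apply: between => //; rewrite -(heightZ _ _ IH); apply: hm.
suff /hu/eqP : usubmx (Z k.+1) = usubmx (Z k) \/ usubmx (Z k.+1) = - usubmx (Z k).
  by rewrite gtn_eqF.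
by case: IH same => -> [] ->; rewrite ?opprK; tauto.
Qed.

End GenericBestApprox.

(** * Best approximations of the matrix built from [theta] *)

Section Twisted.
Variables (R : realType) (n : nat) (xi1 xi2 : R).
Hypothesis n_gt0 : (0 < n)%N.
Hypotheses (xi1_bd : 0 < xi1 < 2^-1) (xi2_bd : 0 < xi2 < 2^-1).
Hypothesis indep : forall a b c : int,
  a%:~R + b%:~R * xi1 + c%:~R * xi2 = 0 -> [/\ a = 0, b = 0 & c = 0].
Variable X : nat -> 'cV[int]_(2 + 1).
Hypothesis hX : ext_best_approx_seq (\row_(i < 2) [:: xi1; xi2]`_i) X.

Let l : 'cV[int]_(2 + 1) -> R := ext_form xi1 xi2.

Definition twisted (theta : 'rV[R]_n) : 'M[R]_(n, 3) :=
  \matrix_(j < n, i < 3)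
    [:: xi1 * theta ord0 j; xi2 * theta ord0 j; theta ord0 j]`_i.

Lemma linform_twisted theta j (w : 'cV[int]_(2 + 1)) :
  linform (twisted theta) j w = theta ord0 j * l w.
Proof.
rewrite /l ext_formE linformE /linform !big_ord_recl big_ord0 !mxE/=.
have -> : lshift 1 (@ord0 1) = ord0 :> 'I_3 by exact: val_inj.
have -> : lshift 1 (@ord_max 1) = lift ord0 ord0 :> 'I_3 by exact: val_inj.
have -> : rshift 2 (@ord0 0) = lift ord0 (lift ord0 ord0) :> 'I_3 by exact: val_inj.
by ring.
Qed.

Section Theta.
Variable theta : 'rV[R]_n.
Hypothesis theta_range : forall j : 'I_n,
  if j == 0%N :> nat then 2^-1 < theta ord0 j < 1 else 0 < theta ord0 j < 2^-1.
Let j0 : 'I_n := Ordinal n_gt0.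

Lemma theta_bounds j : 0 < theta ord0 j < 1.
Proof.
by have := theta_range j; case: ifP => _ /andP[? ?]; apply/andP; split; lra.
Qed.

Lemma theta_max j : theta ord0 j <= theta ord0 j0.
Proof.
have /= /andP[h _] := theta_range j0; have := theta_range j.
case: ifP => [/eqP j00 _|_ /andP[_ ?]]; last by lra.
by have -> : j = j0 by exact: val_inj.
Qed.

Lemma norm_linform_twisted_lt j (w : 'cV[int]_(2 + 1)) : `|l w| <= 2^-1 ->
  `|linform (twisted theta) j w| < 2^-1.
Proof.
rewrite linform_twisted normrM; have /andP[h0 h1] := theta_bounds j.
by rewrite (gtr0_norm h0); move: (normr_ge0 (l w)); set x := `|l w|; nra.
Qed.

Lemma zeta_twisted (w : 'cV[int]_(2 + 1)) : `|l w| <= 2^-1 ->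
  zeta (twisted theta) w = theta ord0 j0 * `|l w|.
Proof.
move=> lw.
have e j : dist_int (linform (twisted theta) j w) = theta ord0 j * `|l w|.
  rewrite dist_int_norm ?ltW ?norm_linform_twisted_lt//.
  by rewrite linform_twisted normrM gtr0_norm//; case/andP: (theta_bounds j).
apply/eqP; rewrite eq_le -{2}e le_zeta andbT; apply/bigmax_leP; split.
  by rewrite mulr_ge0//; case/andP: (theta_bounds j0) => /ltW.
by move=> j _; rewrite e ler_wpM2r// theta_max.
Qed.

Variable l0 : nat.
Hypothesis no_competitor : forall k (w : 'cV[int]_(2 + 1)), (l0 <= k)%N ->
  (sup_height w < sup_height (X k.+1))%N -> 2^-1 < `|l w| ->
  exists j, `|l (X k)| < dist_int (theta ord0 j * `|l w|).

Lemma twisted_gap k (w : 'cV[int]_(2 + 1)) : (l0 <= k)%N -> w != 0 ->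
  (sup_height w < sup_height (X k.+1))%N -> ~ (w = X k \/ w = - X k) ->
  zeta (twisted theta) (X k) < zeta (twisted theta) w.
Proof.
move=> lk w0 wk wX; have /andP[t0 t1] := theta_bounds j0.
rewrite (zeta_twisted (best_ext_form_le_half hX k)).
have [lw|lw] := leP `|l w| 2^-1.
  rewrite zeta_twisted // ltr_pM2l // ltNge; apply/negP => h.
  exact/wX/(best_unique xi1_bd xi2_bd indep hX).
have [j hj] := no_competitor lk wk lw.
apply: lt_le_trans (le_zeta _ j _); rewrite linform_twisted.
have -> : dist_int (theta ord0 j * l w) = dist_int (theta ord0 j * `|l w|).
  by case: (ger0P (l w)) => // _; rewrite mulrN dist_intN.
by apply: le_lt_trans hj; apply: ler_piMl => //; exact: ltW.
Qed.

Lemma twisted_differ (Z : nat -> 'cV[int]_(3 + n)) :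
  ext_best_approx_seq (twisted theta) Z ->
  differ_by_finitely_many_terms Z
    (fun k => col_mx (X k : 'cV[int]_3) (0 : 'cV[int]_n)).
Proof.
move=> hZ; have [hb _ _ _] := hZ.
have [k0 hk0] := ext_best_approx_seq_tail hZ (best_neq0 hX)
  (best_height_mono xi1_bd xi2_bd indep hX) twisted_gap.
exists k0, l0 => i; have [_ hy] := hb (k0 + i)%N.
have small j : `|linform (twisted theta) j (usubmx (Z (k0 + i)%N))| < 2^-1.
  by case: (hk0 i) => ->; rewrite ?linformN ?normrN;
    apply: norm_linform_twisted_lt; exact: best_ext_form_le_half hX _.
(* With [a = L_j] and [|a| < 1/2], the equality [|a + y| = |a|] yields [|y| <= 2 |a| < 1], so the
   integer [y] is 0. *)
have y0 : dsubmx (Z (k0 + i)%N) = 0.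
  apply/colP => j; rewrite [RHS]mxE; apply/eqP; apply: contraT => y0.
  have := hy j; rewrite (dist_int_norm (ltW (small j))).
  have : 1 <= `|(dsubmx (Z (k0 + i)%N) j ord0)%:~R| :> R.
    by rewrite -intr_norm -[1]/(1%:~R) ler_int -gtz0_ge1 normr_gt0.
  have := small j; set a := linform _ _ _; set y := _%:~R => h1 h2 h3.
  have := ler_normB (a + y) a; rewrite addrAC subrr add0r h3.
  by lra.
rewrite -[Z (k0 + i)%N]vsubmxK y0.
by case: (hk0 i) => ->; [left|right; rewrite opp_col_mx oppr0].
Qed.

End Theta.

End Twisted.

(** * Parameters admitting a competitor with [|l| > 1/2] *)

Section Competitors.
Variables (R : realType) (n : nat) (xi1 xi2 : R) (X : nat -> 'cV[int]_(2 + 1)).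
Hypothesis hX : ext_best_approx_seq (\row_(i < 2) [:: xi1; xi2]`_i) X.

Let l : 'cV[int]_(2 + 1) -> R := ext_form xi1 xi2.

(* Integer vectors of height < M_(k+1) are those in the box of radius M_(k+1) - 1. *)
Definition competitor_set (k : nat) : set 'rV[R]_n :=
  \bigcup_(f : {ffun 'I_3 -> 'I_(2 * (sup_height (X k.+1)).-1).+1})
    [set t | 2^-1 < `|l (box_vector f)| /\ forall i, (0 <= t ord0 i <= 1) /\
      dist_int (t ord0 i * `|l (box_vector f)|) <= `|l (X k)|].

(** With [H = M_(k+1)] there are [(2 H - 1)^3 <= 8 H^3] vectors in the box, each costing volume at
    most [(8 |l (X k)|)^n] by [slab_covered]. *)
Lemma competitor_set_covered k : finitely_covered (competitor_set k)
  (8 ^+ n.+1 * ((sup_height (X k.+1))%:R ^+ 3 * `|l (X k)| ^+ n)).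
Proof.
set H := sup_height _; set z := `|l (X k)|.
have H0 : (0 < H)%N by exact/sup_height_gt0/(best_neq0 hX).
apply: (@finitely_coveredW _ _ _
  (#|{ffun 'I_3 -> 'I_(2 * H.-1).+1}|%:R * (8 * z) ^+ n)).
  rewrite card_ffun !card_ord exprMn exprS.
  rewrite [leRHS](_ : _ = (8 * H%:R ^+ 3) * (8 ^+ n * z ^+ n)); last by ring.
  apply: ler_wpM2r; first by rewrite mulr_ge0 ?exprn_ge0 ?normr_ge0.
  rewrite (_ : 8 * H%:R ^+ 3 = ((2 * H) ^ 3)%:R :> R); last first.
    by rewrite natrX natrM; ring.
  by rewrite ler_nat leq_exp2r //; lia.
apply: finitely_covered_bigU => f.
have [lf|lf] := ltP 2^-1 `|l (box_vector f)|.
  have [s [h1 h2 h3]] := slab_covered n lf (normr_ge0 _)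
    (best_ext_form_le_half hX k : z <= _).
  by exists s; split => // t [_]; exact: h2.
(* Vectors with [|l| <= 1/2] contribute the empty set. *)
exists [::]; split.
- by move=> p; rewrite in_nil.
- by move=> t [].
- by rewrite big_nil exprn_ge0 ?mulr_ge0 ?normr_ge0.
Qed.

End Competitors.

(** * Tail of the series and the Borel-Cantelli argument *)

Lemma series_tail_le (R : realType) (u : nat -> R) (eps : R) :
  (forall k, 0 <= u k) -> cvgn (series u) -> 0 < eps ->
  exists l0, forall K, \sum_(k < K) u (l0 + k)%N <= eps.
Proof.
move=> u0 cu e0.
have mono : {homo series u : a b / (a <= b)%N >-> a <= b}.
  by apply/nondecreasing_seqP => k; rewrite seriesSr lerDl.
have /cvgrPdist_lt/(_ _ e0)[l0 _ hl0] := cu; exists l0 => K.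
(* The partial sums increase to the limit, so any block of terms starting at [l0] is at most the
   limit minus the partial sum up to [l0]. *)
have := hl0 l0 (leqnn _); rewrite /= ltr_norml => /andP[_ hlim].
have := nondecreasing_cvgn_le mono cu (l0 + K)%N.
rewrite {1}/series/= (big_cat_nat (n := l0))/= ?leq_addr//.
rewrite -{2}[l0]add0n big_addn addnC addnK !big_mkord.
under [X in _ + X <= _]eq_bigr do rewrite addnC.
by move: hlim; rewrite /series/= !big_mkord; lra.
Qed.

Theorem theorem11 (R : realType) (n : nat) (hn : (1 <= n)%N) (xi1 xi2 : R)
  (hxi1 : 0 < xi1 < 2^-1) (hxi2 : 0 < xi2 < 2^-1)
  (hindep : forall a b c : int,
     a%:~R + b%:~R * xi1 + c%:~R * xi2 = 0 -> [/\ a = 0, b = 0 & c = 0])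
  (X : nat -> 'cV[int]_(2 + 1))
  (hX : ext_best_approx_seq (\row_(i < 2) [:: xi1; xi2]`_i) X)
  (hcvg : cvgn (series (fun k : nat =>
     (sup_height (X k.+1))%:R ^+ 3
     * dist_int (linform (\row_(i < 2) [:: xi1; xi2]`_i) ord0 (usubmx (X k)))
         ^+ n))) :
  lebesgue_null [set theta : 'rV[R]_n |
    (forall j : 'I_n, if j == 0%N :> nat then 2^-1 < theta ord0 j < 1
                      else 0 < theta ord0 j < 2^-1) /\
    ~ (forall Z : nat -> 'cV[int]_(3 + n),
         ext_best_approx_seq
           (\matrix_(j < n, i < 3)
              [:: xi1 * theta ord0 j; xi2 * theta ord0 j; theta ord0 j]`_i) Z ->
         differ_by_finitely_many_terms Z
           (fun k => col_mx (X k : 'cV[int]_3) (0 : 'cV[int]_n)))].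
Proof.
have el k : dist_int (linform (\row_(i < 2) [:: xi1; xi2]`_i) ord0 (usubmx (X k)))
    = `|ext_form xi1 xi2 (X k)| by exact: best_dist hX k.
(* The divisor absorbs the constant of [competitor_set_covered]. *)
move=> eps eps0; have e0 : 0 < eps / 8 ^+ n.+1 by rewrite divr_gt0 ?exprn_gt0.
have [|l0 hl0] := series_tail_le _ hcvg e0.
  by move=> k; rewrite el mulr_ge0 ?exprn_ge0.
have hcov k := competitor_set_covered n hX (l0 + k).
have [|a [b [ab cov vol]]] := cover_of_finite_covers hn (eps := eps) hcov.
  move=> K; rewrite -mulr_sumr mulrC -ler_pdivlMr ?exprn_gt0//.
  apply: le_trans (hl0 K); apply: ler_sum => k _.
  by rewrite el.
(* A parameter outside the boxes lies in no competitor set of index at least [l0], so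
   [twisted_differ] shows that it is not exceptional. *)
exists a, b; split => // t [trange bad]; apply: cov; apply: contrapT => tcov.
apply: bad => Z hZ.
apply: (twisted_differ (l0 := l0) hn hxi1 hxi2 hindep hX trange _ hZ).
move=> k w lk wk lw; apply: contrapT => none; apply: tcov.
exists (k - l0)%N => //; rewrite subnKC//.
have [|f fw] := @box_vector_onto _ (sup_height (X k.+1)).-1 w; first by lia.
exists f => //=; rewrite fw; split => // i.
have /andP[t0 t1] := theta_bounds trange i; split; first by rewrite !ltW.
by rewrite leNgt; apply/negP => h; apply: none; exists i.
Qed.
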